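(* Let $\lambda$ be a finite plane partition, and let $\mathbf{m}=(m_2,m_3,m_4)\in\mathbb{Z}^3$ with $m_2+m_3+m_4=-2$. For every $i,j\in\{2,3,4\}$, $$(-1)^{\sigma_i(\lambda)}\,e^{\mathbf{T}}(-\mathsf{e}^i_\lambda)=(-1)^{\sigma_j(\lambda)}\,e^{\mathbf{T}}(-\mathsf{e}^j_\lambda),$$ where $\mathsf{e}^i_\lambda$, $\sigma_i(\lambda)$ (both depending on $\mathbf{m}$) and $e^{\mathbf{T}}$ are as defined in the context.
   Context: Torus and representation ring. $\mathbf{T}=\{t_1t_2t_3t_4=1\}\subset(\mathbb{C}^* )^4$, and $K^0_{\mathbf{T}}(\mathrm{pt})=\mathbb{Z}[t_1^{\pm1},t_2^{\pm1},t_3^{\pm1},t_4^{\pm1}]/(t_1t_2t_3t_4-1)$ is the ring of virtual $\mathbf{T}$-representations. $\overline{(\cdot)}$ denotes the dual, i.e. the involution $t_a\mapsto t_a^{-1}$. For a set of indices $I$, $P_I=\prod_{a\in I}(1-t_a)$, so $\overline{P_I}=\prod_{a\in I}(1-t_a^{-1})$. Movable classes and Euler class. A class $V=\sum_\mu m_\mu t^\mu\in K^0_{\mathbf{T}}(\mathrm{pt})$ (sum over distinct characters of $\mathbf{T}$, $m_\mu\in\mathbb{Z}$) is $\mathbf{T}$-movable if the trivial character has multiplicity $0$ in $V$. Put $\lambda^{\mathrm{wt}}_a=c_1^{\mathbf{T}}(t_a)$, so that $\sum_a\lambda^{\mathrm{wt}}_a=0$. For $\mathbf{T}$-movable $V$,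 $e^{\mathbf{T}}(V)=\prod_\mu(\sum_a\mu_a\lambda^{\mathrm{wt}}_a)^{m_\mu}$, an element of the fraction field of $\mathbb{Q}[\lambda^{\mathrm{wt}}_1,\dots,\lambda^{\mathrm{wt}}_4]/(\sum_a\lambda^{\mathrm{wt}}_a)$. Geometric setting. $\mathbf{m}$ is the multidegree of the normal bundle $\mathcal{O}(m_2)\oplus\mathcal{O}(m_3)\oplus\mathcal{O}(m_4)$ of a torus-invariant line $\mathbb{P}^1$, given locally by $\{x_2=x_3=x_4=0\}$, in a toric Calabi-Yau 4-fold (whence $m_2+m_3+m_4=-2$), and $\lambda$ is the profile of a torus-fixed non-reduced leg along this line. Plane partitions. A finite plane partition is a finite subset $\lambda\subset\mathbb{Z}^3_{\ge0}$ closed under passing to componentwise smaller elements; coordinates are labelled $(a_2,a_3,a_4)$, and $|\lambda|$ is its cardinality. Put $Z_\lambda=\sum_{(a_2,a_3,a_4)\in\lambda}t_2^{a_2}t_3^{a_3}t_4^{a_4}$ and $$f_{\mathbf{m}}(\lambda)=\sum_{(a_2,a_3,a_4)\in\lambda}(1-m_2a_2-m_3a_3-m_4a_4).$$ Edge terms. Let $\widetilde{(\cdot)}:K^0_{\mathbf{T}}(\mathrm{pt})\to K^0_{\mathbf{T}}(\mathrm{pt})$ be $V(t_1,t_2,t_3,t_4)\mapsto V(t_1^{-1},t_2t_1^{-m_2},t_3t_1^{-m_3},t_4t_1^{-m_4})$. For $\{i,k,l\}=\{2,3,4\}$ define $$\mathsf{f}^i_\lambda=-Z_\lambda+\overline{P_{kl}}\,Z_\lambda\overline{Z_\lambda},\qquad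 \mathsf{e}^i_\lambda=t_1^{-1}\frac{\mathsf{f}^i_\lambda}{1-t_1^{-1}}-\frac{\widetilde{\mathsf{f}^i_\lambda}}{1-t_1^{-1}}.$$ Here $\mathsf{f}^i_\lambda$ is written as a Laurent polynomial in $t_2,t_3,t_4$; $\mathsf{e}^i_\lambda$ is an element of $K^0_{\mathbf{T}}(\mathrm{pt})$ and is $\mathbf{T}$-movable, so $e^{\mathbf{T}}(-\mathsf{e}^i_\lambda)$ is defined. Sign. For $\{i,k,l\}=\{2,3,4\}$, $$\sigma_i(\lambda)=f_{\mathbf{m}}(\lambda)+|\lambda|\,m_i+\#\{(a_2,a_3,a_4)\in\lambda:\ a_k=a_l<a_i\}.$$ *)

(* Defs.v *)
From HB Require Import structures.
From mathcomp Require Import all_boot all_order all_algebra finmap ring.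
From mathcomp.multinomials Require Import -(notations) mpoly.
From mathcomp.multinomials Require Import monalg.

Set Implicit Arguments.
Unset Strict Implicit.
Unset Printing Implicit Defensive.

Import Order.TTheory GRing.Theory Num.Theory.

Local Open Scope fset_scope.
Local Open Scope ring_scope.

(* The character lattice of T is Z^4 / Z(1,1,1,1).  It is identified with Z^3
   by mu |-> (mu_2 - mu_1, mu_3 - mu_1, mu_4 - mu_1), that is, t_1 is eliminated
   by t_1 = (t_2 t_3 t_4)^-1.  Throughout, an index a in {1,2,3,4} is a - 1 in
   'I_4, an index a in {2,3,4} is a - 2 in 'I_3, and lift ord0 : 'I_3 -> 'I_4 is
   the inclusion of the latter in the former. *)
Definition character : Type := 'rV[int]_3.
HB.instance Definition _ := GRing.Zmodule.on character.

Definition chi (mu : 'rV[int]_4) : character :=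
  \row_j (mu 0 (lift ord0 j) - mu 0 ord0).

Lemma chi_eqP (mu nu : 'rV[int]_4) :
  chi mu = chi nu <-> exists n : int, nu = mu + const_mx n.
Proof.
split=> [/rowP E|[n ->]]; last by apply/rowP => j; rewrite !mxE; ring.
exists (nu 0 ord0 - mu 0 ord0); apply/rowP => a; rewrite !mxE.
case: (unliftP ord0 a) => [j ->|->]; last by ring.
move: (E j); rewrite !mxE => /eqP; rewrite subr_eq => /eqP ->; ring.
Qed.

Lemma chi_surj (w : character) : exists mu, chi mu = w.
Proof.
exists (\row_a if unlift ord0 a is Some j then (w : 'rV[int]_3) 0 j else 0).
by apply/rowP => j; rewrite !mxE liftK unlift_none subr0.
Qed.

Lemma chiD : {morph chi : mu nu / mu + nu}.
Proof. by move=> mu nu; apply/rowP => j; rewrite !mxE; ring. Qed.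

(* K^0_T(pt) is the group ring of the character lattice: V@_mu is the
   multiplicity of the character mu in V, and << mu >> is the class t^mu.  The
   library's product on {malg R[K]} requires a monoid K without nontrivial
   units, hence the type alias and the ring structure built here. *)
Definition K0T : Type := {malg int[character]}.
HB.instance Definition _ := GRing.Zmodule.on K0T.

Section K0Ring.
Implicit Types (g : K0T) (k : character).
Local Notation one := (<< (0 : character) >> : K0T).

Definition K0mul g1 g2 : K0T :=
  \sum_(k1 <- msupp g1) \sum_(k2 <- msupp g2)
    (<< g1@_k1 * g2@_k2 *g (k1 + k2 : character) >> : K0T).

Lemma K0mulw (d1 d2 : {fset character}) g1 g2 :
  msupp g1 `<=` d1 -> msupp g2 `<=` d2 ->
  K0mul g1 g2 = \sum_(k1 <- d1) \sum_(k2 <- d2)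
    (<< g1@_k1 * g2@_k2 *g (k1 + k2 : character) >> : K0T).
Proof.
move=> le_d1 le_d2; rewrite /K0mul (big_fset_incl _ le_d1) /=.
  apply/eq_bigr=> k1 _; apply/big_fset_incl => // k _ /mcoeff_outdom ->.
  by rewrite mulr0 monalgU0.
move=> k _ /mcoeff_outdom g1k.
by rewrite big1 => // k' _; rewrite g1k mul0r monalgU0.
Qed.

Lemma K0mulC : commutative K0mul.
Proof.
move=> g1 g2; rewrite /K0mul exchange_big /=.
by apply/eq_bigr=> k1 _; apply/eq_bigr=> k2 _; rewrite mulrC addrC.
Qed.

Lemma K0mulDl : left_distributive K0mul +%R.
Proof.
move=> g1 g2 g.
rewrite (K0mulw (msuppD_le _ _) (fsubset_refl _)).
rewrite (K0mulw (fsubsetUl _ (msupp g2)) (fsubset_refl (msupp g))).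
rewrite (K0mulw (fsubsetUr (msupp g1) _) (fsubset_refl (msupp g))).
rewrite -big_split /=; apply/eq_bigr=> k1 _.
rewrite -big_split /=; apply/eq_bigr=> k2 _.
by rewrite mcoeffD mulrDl monalgUD.
Qed.

Lemma K0mulDr : right_distributive K0mul +%R.
Proof. by move=> g g1 g2; rewrite !(K0mulC g) K0mulDl. Qed.

Lemma K0mul0 g : K0mul 0 g = 0.
Proof. by rewrite /K0mul msupp0 big_seq_fset0. Qed.

Lemma K0mulg0 g : K0mul g 0 = 0.
Proof. by rewrite K0mulC K0mul0. Qed.

Lemma K0mulUU c1 c2 k1 k2 :
  K0mul << c1 *g k1 >> << c2 *g k2 >> = << c1 * c2 *g (k1 + k2 : character) >>.
Proof. by rewrite (K0mulw msuppU_le msuppU_le) !big_seq_fset1 !mcoeffUU. Qed.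

Lemma K0mulEl g1 g2 :
  K0mul g1 g2 = \sum_(k <- msupp g1) K0mul << g1@_k *g k >> g2.
Proof.
by rewrite {1}[g1]monalgE (big_morph (K0mul^~ _)
  (fun _ _ => K0mulDl _ _ _) (K0mul0 _)).
Qed.

Lemma K0mulEr g1 g2 :
  K0mul g1 g2 = \sum_(k <- msupp g2) K0mul g1 << g2@_k *g k >>.
Proof. by rewrite K0mulC K0mulEl; apply/eq_bigr=> k _; rewrite K0mulC. Qed.

Lemma K0mul1 : left_id one K0mul.
Proof.
move=> g; rewrite K0mulEr [RHS]monalgE.
by apply/eq_bigr=> k _; rewrite K0mulUU mul1r add0r.
Qed.

Lemma K0mulA : associative K0mul.
Proof.
move=> g1 g2 g3.
rewrite [RHS](K0mulEr (K0mul g1 g2)) [K0mul g2 g3]K0mulEr.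
rewrite (big_morph (K0mul _) (fun _ _ => K0mulDr _ _ _) (K0mulg0 _)).
apply/eq_bigr=> k3 _; rewrite [K0mul g2 _]K0mulEl.
rewrite (big_morph (K0mul _) (fun _ _ => K0mulDr _ _ _) (K0mulg0 _)).
rewrite [K0mul g1 g2]K0mulEr.
rewrite (big_morph (K0mul^~ _) (fun _ _ => K0mulDl _ _ _) (K0mul0 _)).
apply/eq_bigr=> k2 _; rewrite K0mulUU [LHS]K0mulEl [K0mul g1 _]K0mulEl.
rewrite (big_morph (K0mul^~ _) (fun _ _ => K0mulDl _ _ _) (K0mul0 _)).
by apply/eq_bigr=> k1 _; rewrite !K0mulUU mulrA addrA.
Qed.

Lemma K01_neq0 : one != 0.
Proof. by rewrite monalgU_eq0. Qed.

End K0Ring.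

HB.instance Definition _ := GRing.Zmodule_isComNzRing.Build K0T
  K0mulA K0mulC K0mul1 K0mulDl K01_neq0.

Definition chr (w : character) : K0T := << w >>.

Lemma chr0 : chr 0 = 1. Proof. by []. Qed.

Lemma chrD u v : chr (u + v) = chr u * chr v.
Proof. by rewrite [RHS]K0mulUU mulr1. Qed.

Definition t (a : 'I_4) : K0T := chr (chi (delta_mx 0 a)).

Lemma prod_t : \prod_(a < 4) t a = 1.
Proof.
rewrite /t !big_ord_recl big_ord0 mulr1 -!chrD -chr0; congr chr.
by apply/rowP => -[[|[|[|//]]] hj]; rewrite !mxE.
Qed.

(* The additive map K^0_T(pt) -> K^0_T(pt) induced by a map of characters. *)
Definition mapchar (phi : character -> character) (V : K0T) : K0T :=
  \sum_(mu <- msupp V) (<< V@_mu *g phi mu >> : K0T).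

Lemma mapcharw phi (d : {fset character}) (V : K0T) : msupp V `<=` d ->
  mapchar phi V = \sum_(mu <- d) (<< V@_mu *g phi mu >> : K0T).
Proof.
move=> le; apply: big_fset_incl => // k _ /mcoeff_outdom ->.
by rewrite monalgU0.
Qed.

Lemma mapcharD phi : {morph mapchar phi : V W / V + W}.
Proof.
move=> V W; rewrite (mapcharw _ (msuppD_le V W)).
rewrite (mapcharw _ (fsubsetUl _ (msupp W))).
rewrite (mapcharw _ (fsubsetUr (msupp V) _)) -big_split /=.
by apply/eq_bigr => k _; rewrite mcoeffD monalgUD.
Qed.

Lemma mapchar_chr phi w : mapchar phi (chr w) = chr (phi w).
Proof. by rewrite (mapcharw _ msuppU_le) big_seq_fset1 mcoeffUU. Qed.

Definition dual : K0T -> K0T := mapchar -%R.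

Lemma t_dual a : t a * dual (t a) = 1.
Proof. by rewrite /dual mapchar_chr -chrD subrr. Qed.

(* The action on characters of the substitution t_1 -> t_1^-1,
   t_j -> t_j t_1^(-m_j) for j = 2, 3, 4, read off on the representative
   t_2^(w_2) t_3^(w_3) t_4^(w_4).  The substitution respects
   t_1 t_2 t_3 t_4 = 1 because m_2 + m_3 + m_4 = -2: see tilde_t1. *)
Definition tilde_char (m : 'I_3 -> int) (w : character) : character :=
  \sum_(j < 3) (chi (delta_mx 0 (lift ord0 j))
                - chi (delta_mx 0 ord0) *~ m j) *~ (w : 'rV[int]_3) 0 j.

Definition tilde (m : 'I_3 -> int) : K0T -> K0T := mapchar (tilde_char m).

Lemma tilde_charE m w :
  tilde_char m w
  = w - chi (delta_mx 0 ord0) *~ (\sum_(j < 3) m j * (w : 'rV[int]_3) 0 j).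
Proof.
rewrite /tilde_char.
under eq_bigr do rewrite mulrzBl -mulrzA.
rewrite sumrB -mulrz_sumr; congr (_ - _).
apply/rowP => k; rewrite summxE (bigD1 k) //= big1 => [|j neq].
  rewrite addr0 -scaler_int !mxE /= intz.
  by rewrite (inj_eq (@lift_inj _ _)) !eqxx subr0 mulr1.
rewrite -scaler_int !mxE /= (inj_eq (@lift_inj _ _)).
by rewrite [k == j]eq_sym (negPf neq) subr0 mulr0.
Qed.

Lemma tilde_t1 m : \sum_(j < 3) m j = - 2%:Z ->
  tilde m (t ord0) = dual (t ord0).
Proof.
move=> hm; rewrite /tilde /dual !mapchar_chr tilde_charE; congr chr.
rewrite (eq_bigr (fun j => - m j)); last first.
  by move=> j _; rewrite !mxE /= mulrN1.
rewrite sumrN hm opprK; set c := chi _.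
by rewrite -[Posz 2]/(1 + 1 : int) mulrzDr mulr1z opprD addrA subrr sub0r.
Qed.

Lemma tilde_t m (j : 'I_3) :
  tilde m (t (lift ord0 j))
  = chr (chi (delta_mx 0 (lift ord0 j)) + chi (delta_mx 0 ord0) *~ - m j).
Proof.
rewrite /tilde mapchar_chr tilde_charE; congr chr; congr (_ + _).
rewrite (bigD1 j) //= big1 => [|k neq]; rewrite !mxE /=.
  by rewrite eqxx subr0 mulr1 mulrNz.
case: eqP => [/lift_inj kj|_]; last by rewrite subr0 mulr0.
by rewrite kj eqxx in neq.
Qed.

(* A box (a_2, a_3, a_4). *)
Notation box := {ffun 'I_3 -> nat}.

Definition plane_partition (lam : {fset box}) : Prop :=
  forall a b : box, b \in lam -> (forall j, (a j <= b j)%N) -> a \in lam.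

Definition Zlam (lam : {fset box}) : K0T :=
  \sum_(a <- lam) \prod_(j < 3) t (lift ord0 j) ^+ a j.

Definition f_m (m : 'I_3 -> int) (lam : {fset box}) : int :=
  \sum_(a <- lam) (1 - \sum_(j < 3) m j * (a j)%:Z).

(* P_kl, where {i, k, l} = {2, 3, 4}. *)
Definition Pkl (i : 'I_3) : K0T :=
  \prod_(k < 3 | k != i) (1 - t (lift ord0 k)).

Definition fterm (lam : {fset box}) (i : 'I_3) : K0T :=
  - Zlam lam + dual (Pkl i) * Zlam lam * dual (Zlam lam).

Lemma divides_t1 m (V : K0T) :
  exists e : K0T,
    (1 - dual (t ord0)) * e == dual (t ord0) * V - tilde m V.
Proof.
set s := dual (t ord0).
suff [e He] : exists e, (1 - s) * e = V - tilde m V.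
  by exists (e - V); rewrite mulrBr He mulrBl mul1r; apply/eqP; ring.
have cyc (n : int) : exists e, (1 - s) * e = 1 - chr (- chi (delta_mx 0 ord0) *~ n).
  have nat_case (k : nat) :
      exists e, (1 - s) * e = 1 - chr (- chi (delta_mx 0 ord0) *~ k%:Z).
    elim: k => [|k [e He]]; first by exists 0; rewrite mulr0 chr0 subrr.
    exists (1 + s * e); rewrite mulrDr mulrCA He intS mulrzDr chrD.
    by rewrite /s /dual mapchar_chr; set x := chr _; set y := chr _; ring.
  case: n => k //; have [e He] := nat_case k.+1.
  rewrite NegzE mulrNz; set u := (- _ *~ _) in He *.
  exists (- chr (- u) * e); rewrite mulrCA He mulNr mulrBr mulr1 -chrD.
  by rewrite addNr chr0 opprB.
have VE : V = \sum_(w <- msupp V) (<< V@_w *g w >> : K0T) := monalgE V.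
rewrite {1}VE /tilde /mapchar -sumrB.
elim/big_ind: _ => [|x y [e He] [f Hf]|w _].
- by exists 0; rewrite mulr0.
- by exists (e + f); rewrite mulrDr He Hf.
rewrite tilde_charE; set n := \sum_(_ < _) _; have [e He] := cyc n.
exists ((<< V@_w *g w >> : K0T) * e); rewrite mulrCA He mulrBr mulr1.
by rewrite mulNrz [_ * chr _]K0mulUU mulr1.
Qed.

(* The quotient (t_1^-1 f - f~) / (1 - t_1^-1) in K^0_T(pt); it exists by
   divides_t1 and is unique by edge_uniq. *)
Definition edge (m : 'I_3 -> int) (lam : {fset box}) (i : 'I_3) : K0T :=
  xchoose (divides_t1 m (fterm lam i)).

Lemma edgeP m lam i :
  (1 - dual (t ord0)) * edge m lam i
  = dual (t ord0) * fterm lam i - tilde m (fterm lam i).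
Proof. exact: (eqP (xchooseP (divides_t1 m (fterm lam i)))). Qed.

Lemma mcoeffMU (V : K0T) c (w u : character) :
  ((<< c *g w >> : K0T) * V)@_u = c * V@_(u - w : character).
Proof.
rewrite [LHS](_ : _ = (K0mul << c *g w >> V)@_u) //.
rewrite K0mulEr raddf_sum /= [in RHS](monalgE V) raddf_sum mulr_sumr /=.
apply: eq_bigr => k _.
by rewrite K0mulUU !mcoeffU mulrnAr [k == _]eq_sym subr_eq addrC eq_sym.
Qed.

Lemma t1_regular (V : K0T) : (1 - dual (t ord0)) * V = 0 -> V = 0.
Proof.
rewrite /dual mapchar_chr; set c := chi _ => /eqP.
rewrite mulrBl mul1r subr_eq0 => /eqP E.
apply/malgP => u; rewrite mcoeff0.
have shift k (n : nat) : V@_(k + c *+ n : character) = V@_k.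
  elim: n => [|n <-]; first by rewrite mulr0n addr0.
  by rewrite {2}E mcoeffMU mul1r opprK mulrS addrCA [c + _]addrC.
apply/eqP; rewrite mcoeff_eq0; apply/negP => uV.
pose s := [seq (u + c *+ n : character) | n <- iota 0 (size (msupp V)).+1].
have us : uniq s.
  rewrite map_inj_uniq ?iota_uniq // => a b /addrI /rowP /(_ ord0).
  rewrite -!scaler_nat !mxE /= => /eqP.
  by rewrite sub0r !mulrN1 eqr_opp => /eqP []; rewrite !natz => -[].
have sV : {subset s <= msupp V}.
  by move=> _ /mapP [n _ ->]; rewrite -mcoeff_neq0 shift mcoeff_neq0.
by have := uniq_leq_size us sV; rewrite size_map size_iota ltnn.
Qed.

Lemma edge_uniq m lam i (e : K0T) :
  (1 - dual (t ord0)) * e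
    = dual (t ord0) * fterm lam i - tilde m (fterm lam i) ->
  e = edge m lam i.
Proof.
rewrite -(edgeP m) => /eqP; rewrite -subr_eq0 -mulrBr => /eqP /t1_regular /eqP.
by rewrite subr_eq0 => /eqP.
Qed.

(* The fraction field of Q[l_1, l_2, l_3, l_4] / (l_1 + l_2 + l_3 + l_4), with
   l_1 = - l_2 - l_3 - l_4 eliminated. *)
Definition wt_field := {fraction mpoly 3 rat}.

Definition lambda_wt (a : 'I_4) : wt_field :=
  let X j : wt_field := tofrac (mpolyX rat (mnm1 j)) in
  if unlift ord0 a is Some j then X j else - \sum_(j < 3) X j.

Lemma sum_lambda_wt : \sum_(a < 4) lambda_wt a = 0.
Proof.
rewrite big_ord_recl /lambda_wt unlift_none.
by under [X in _ + X]eq_bigr do rewrite liftK; rewrite addNr.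
Qed.

Definition weight (w : character) : wt_field :=
  \sum_(j < 3) lambda_wt (lift ord0 j) *~ (w : 'rV[int]_3) 0 j.

Lemma weight_chi (mu : 'rV[int]_4) :
  weight (chi mu) = \sum_(a < 4) lambda_wt a *~ mu 0 a.
Proof.
rewrite big_ord_recl /weight; under eq_bigr do rewrite mxE mulrzBr.
rewrite sumrB addrC -mulrz_suml -mulNrz; congr (_ *~ _ + _).
by apply/eqP; rewrite eq_sym -addr_eq0 -big_ord_recl sum_lambda_wt.
Qed.

(* Only meaningful on movable classes: a trivial character in V contributes
   the value 0. *)
Definition euler (V : K0T) : wt_field :=
  \prod_(mu <- msupp V) weight mu ^ V@_mu.

Definition sigma (m : 'I_3 -> int) (lam : {fset box}) (i : 'I_3) : int :=
  f_m m lam + #|` lam|%:Z * m i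
  + #|` [fset a in lam | [forall k, (k != i) ==> (a k < a i)%N]
         & [forall k, forall l, (k != i) && (l != i) ==> (a k == a l)]]|%:Z.

(* Main.v *)
From HB Require Import structures.
Require Import Defs.
From mathcomp Require Import all_boot all_order all_algebra finmap ring zify.
From mathcomp.multinomials Require Import -(notations) mpoly.
From mathcomp.multinomials Require Import monalg.

Set Implicit Arguments.
Unset Strict Implicit.
Unset Printing Implicit Defensive.

Import GRing.Theory Num.Theory.
Local Open Scope fset_scope.
Local Open Scope ring_scope.

(** Write c for the character of t_1 and s = t_1^-1.  Since
    t_1 t_2 t_3 t_4 = 1, the dual of P_kl equals

      1 - (t_2^-1 + t_3^-1 + t_4^-1) + t_i^-1 + t_1 t_i,

    so only the last two terms make f^i depend on i.  Multiplied by Z and the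
    dual of Z they become the sum, over pairs of boxes (a, b), of
    t^w + t^(c - w) with w = a - b - e_i ([fterm_split]).  The edge operator
    V |-> (s V - tilde V) / (1 - s) is additive, so each edge term e^i is the
    sum of a class K that does not depend on i and of the edge terms of these
    self-dual pairs.

    The edge term of t^w + t^(c - w) telescopes to a sum of n(w) - 1 classes
    t^z - t^(-z) (of their opposites, in number 1 - n(w), if n(w) < 1), where n(w) = m_2 w_2 + m_3 w_3 + m_4 w_4.  The weights of z
    and -z are opposite, so such a class has Euler class -1 when z is not
    trivial.  A trivial z can only occur when w is a multiple of c, and then
    the edge term of the pair is zero although n(w) - 1 is odd.  Hence a pair
    contributes the sign with exponent n(w) - 1 + [w is a multiple of c]
    ([edge_pair]).  Modulo 2, the sum of these exponents over all (a, b) is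
    |lambda| (m_i + 1) + Q_i, where Q_i counts the pairs (a, b) such that
    a - b - e_i is a multiple of (1, 1, 1) ([euler_edge]).

    It remains to see that Q_i + #{a : a_k = a_l < a_i} modulo 2 does not
    depend on i.  Adding to a plane partition a box a at a corner increases
    Q_i by min(a + e_i) + min(a + e_k + e_l): the part of a plane partition
    lying on one diagonal is an initial segment of it, and its length can be
    read off at its end.  A comparison of the three coordinates of a shows that
    the increment of the whole expression is odd exactly when the smallest
    coordinate of a occurs once ([corner_parity]), a condition without i. *)

(** * Signs and the Euler class *)

(** Signs are indexed by 'F_2, so that integers and cardinals are reduced
    modulo 2 by ring morphisms. *)
Definition psign (s : 'F_2) : wt_field := (-1) ^+ s.

Lemma F2_addrr (s : 'F_2) : s + s = 0.
Proof. by apply: addrr_pchar2; apply: pchar_Fp. Qed.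

Lemma F2_oppr (s : 'F_2) : - s = s.
Proof. by apply/eqP; rewrite eq_sym -addr_eq0 F2_addrr. Qed.

Lemma F2_mulrr (s : 'F_2) : s * s = s.
Proof. by case: s => [[|[|//]] ?]; apply: val_inj. Qed.

Lemma psignD s u : psign (s + u) = psign s * psign u.
Proof.
by case: s u => [[|[|//]] ?] [[|[|//]] ?]; rewrite /psign /= ?expr0 ?expr1;
   rewrite ?mulr1 ?mul1r ?mulrNN ?mulr1.
Qed.

Lemma psign_int (n : int) : (-1) ^ n = psign n%:~R.
Proof.
have N1 : (-1 : wt_field) != 0 by rewrite oppr_eq0 oner_eq0.
have p1 : psign 1 = -1 by rewrite /psign /= expr1.
elim/int_rect: n => [|n IH|n IH]; first by rewrite /psign expr0.
  by rewrite intS addrC expfzDr // IH expr1z intrD psignD p1.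
rewrite intS opprD addrC expfzDr // IH intrD psignD; congr (_ * _).
by rewrite exprN1 invrN1 mulrNz -p1; congr psign; apply: val_inj.
Qed.

(** The weights of t_2, t_3, t_4 are the indeterminates, so a character can be
    read off the coefficients of its weight. *)
Lemma weight_neq0 (w : character) : w != 0 -> weight w != 0.
Proof.
apply: contraNneq => w0; apply/eqP/rowP => k.
pose p : mpoly 3 rat := \sum_(j < 3) mpolyX rat (mnm1 j) *~ (w : 'rV[int]_3) 0 j.
have wE : weight w = tofrac p.
  rewrite /weight raddf_sum; apply: eq_bigr => j _.
  by rewrite raddfMz /lambda_wt liftK.
have p0 : p = 0 by apply/eqP; rewrite -tofrac_eq0 -wE w0.
have: mpoly.mcoeff (mnm1 k) p = 0 by rewrite p0 mpoly.mcoeff0.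
rewrite raddf_sum (bigD1 k) //= big1 ?addr0 => [|j njk].
  rewrite raddfMz /= mpoly.mcoeffX eqxx mxE => /eqP.
  by rewrite intr_eq0 => /eqP.
by rewrite raddfMz /= mpoly.mcoeffX eq_mnm1 (negPf njk) mul0rz.
Qed.

Lemma weightN w : weight (- w) = - weight w.
Proof. by rewrite /weight -sumrN; apply: eq_bigr => j _; rewrite mxE mulrNz. Qed.

Lemma eulerw (d : {fset character}) (V : K0T) : msupp V `<=` d ->
  euler V = \prod_(mu <- d) weight mu ^ V@_mu.
Proof.
by move=> le; apply: big_fset_incl => // k _ /mcoeff_outdom ->; rewrite expr0z.
Qed.

(** Exponents add up where the weight is invertible, that is, away from the
    trivial character; there, both sides have the same, possibly zero, factor
    coming from W. *)
Lemma eulerD (V W : K0T) : V@_0 = 0 -> euler (W + V) = euler W * euler V.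
Proof.
move=> V0; rewrite (eulerw (msuppD_le W V)).
rewrite (eulerw (fsubsetUl _ (msupp V))) (eulerw (fsubsetUr (msupp W) _)).
rewrite -big_split /=; apply: eq_bigr => k _; rewrite mcoeffD.
have [->|k0] := eqVneq k 0; first by rewrite V0 addr0 expr0z mulr1.
by rewrite expfzDr // weight_neq0.
Qed.

Lemma euler0 : euler 0 = 1.
Proof. by rewrite /euler msupp0 big_seq_fset0. Qed.

Lemma eulerN V : euler (- V) = (euler V)^-1.
Proof.
rewrite /euler msuppN -prodfV; apply: eq_bigr => k _.
by rewrite mcoeffN invr_expz.
Qed.

Lemma euler_chr w : euler (chr w) = weight w.
Proof. by rewrite (eulerw msuppU_le) big_seq_fset1 mcoeffUU expr1z. Qed.

(** The multiplicity of the trivial character is part of the notion because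
    [eulerD] asks for it; this makes the notion stable under sums. *)
Definition has_euler_sign (V : K0T) (s : 'F_2) : Prop :=
  V@_0 = 0 /\ euler V = psign s.

Lemma has_euler_sign0 : has_euler_sign 0 0.
Proof. by split; rewrite ?mcoeff0 // euler0 /psign expr0. Qed.

Lemma has_euler_signD V W s u :
  has_euler_sign V s -> has_euler_sign W u -> has_euler_sign (V + W) (s + u).
Proof.
by move=> [V0 eV] [W0 eW]; split; rewrite ?mcoeffD ?V0 ?W0 // eulerD // eV eW psignD.
Qed.

Lemma has_euler_signN V s : has_euler_sign V s -> has_euler_sign (- V) s.
Proof.
move=> [V0 eV]; split; first by rewrite mcoeffN V0 oppr0.
by rewrite eulerN eV /psign -exprVn invrN1.
Qed.

Lemma has_euler_sign_pair w : w != 0 -> has_euler_sign (chr w - chr (- w)) 1.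
Proof.
move=> w0; have c0 u : u != 0 -> (chr u)@_0 = 0.
  by move=> u0; rewrite mcoeffU (negPf u0).
have w'0 : - w != 0 by rewrite oppr_eq0.
split; first by rewrite mcoeffB !c0 ?subr0.
rewrite eulerD ?mcoeffN ?c0 ?oppr0 // eulerN !euler_chr weightN invrN mulrN.
by rewrite divff ?weight_neq0.
Qed.

(** * Edge terms of pairs of characters *)

Lemma mapchar_zmod phi : zmod_morphism (mapchar phi).
Proof.
move=> V W; apply/eqP; rewrite eq_sym subr_eq -mapcharD; apply/eqP.
by rewrite subrK.
Qed.

HB.instance Definition _ phi :=
  GRing.isZmodMorphism.Build K0T K0T (mapchar phi) (mapchar_zmod phi).

Definition wt1 : character := chi (delta_mx 0 ord0).

(** The exponent n(w) such that tilde sends t^w to t^w t_1^(-n(w)). *)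
Definition mdeg_char (m : 'I_3 -> int) (w : character) : int :=
  \sum_(j < 3) m j * (w : 'rV[int]_3) 0 j.

Lemma mdeg_charB m u v : mdeg_char m (u - v) = mdeg_char m u - mdeg_char m v.
Proof. by rewrite -sumrB; apply: eq_bigr => j _; rewrite !mxE mulrBr. Qed.

Lemma wt1E j : (wt1 : 'rV[int]_3) 0 j = -1.
Proof. by rewrite !mxE. Qed.

Lemma mdeg_wt1 m : \sum_(j < 3) m j = - 2%:Z -> mdeg_char m wt1 = 2%:Z.
Proof.
move=> hm; rewrite -[RHS]opprK -hm -sumrN.
by apply: eq_bigr => j _; rewrite wt1E mulrN1.
Qed.

Lemma tilde_chr m w : tilde m (chr w) = chr (w - wt1 *~ mdeg_char m w).
Proof. by rewrite /tilde mapchar_chr tilde_charE. Qed.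

Lemma dual_chr w : dual (chr w) = chr (- w).
Proof. exact: mapchar_chr. Qed.

(** Edge terms are characterised by an equation rather than computed by a
    division, so that additivity and uniqueness are immediate. *)
Definition is_edge m (V E : K0T) : Prop :=
  (1 - dual (t ord0)) * E = dual (t ord0) * V - tilde m V.

Lemma is_edgeD m V W E F :
  is_edge m V E -> is_edge m W F -> is_edge m (V + W) (E + F).
Proof. by rewrite /is_edge /tilde => hE hF; rewrite mulrDr hE hF raddfD /=; ring. Qed.

Lemma is_edge_inj m V E F : is_edge m V E -> is_edge m V F -> E = F.
Proof.
move=> hE hF; apply/eqP; rewrite -subr_eq0; apply/eqP/t1_regular.
by rewrite mulrBr hE hF subrr.
Qed.

Definition on_diagonal (w : character) : bool :=
  [forall j, (w : 'rV[int]_3) 0 j == (w : 'rV[int]_3) 0 ord0].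

Lemma on_diagonalP w : reflect (exists r : int, w = wt1 *~ r) (on_diagonal w).
Proof.
apply: (iffP forallP) => [h|[r ->] j]; last first.
  by rewrite -!scaler_int !mxE.
exists (- (w : 'rV[int]_3) 0 ord0); apply/rowP => j.
by rewrite -scaler_int !mxE /= (eqP (h j)) intz sub0r mulrN1 opprK.
Qed.

(** The right-hand side is s V - tilde V for V = t^w + t^(c - w) and
    k = n(w) - 1.  For k = 0 it vanishes, and passing from k to k + 1 adds
    (1 - s) (t^z - t^(-z)) with z = w - (k + 1) c, which is not trivial because
    w is not a multiple of c. *)
Lemma edge_pair_telescope w (k : int) : ~~ on_diagonal w ->
  exists2 H : K0T,
    (1 - dual (t ord0)) * H = dual (t ord0) * chr w - chr (w - wt1 - wt1 *~ k)
      + chr (- w) - chr (- w + wt1 *~ k)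
    & has_euler_sign H k%:~R.
Proof.
move=> ndiag; rewrite dual_chr -/wt1.
(* The facts uE and vE write the classes that vary with k in terms of t^(z n)
   and of its dual; uS and vS relate consecutive n by a factor t_1^-1. *)
pose z n : character := w - wt1 *~ n.
have z0 n : z n != 0.
  apply: contraNneq ndiag => /eqP; rewrite subr_eq0 => /eqP ->.
  by apply/on_diagonalP; exists n.
have uE n : w - wt1 - wt1 *~ n = z (n + 1).
  by rewrite /z mulrzDr mulr1z opprD addrA addrAC.
have vE n : chr (- w + wt1 *~ n) = chr (- wt1) * chr (- z (n + 1)).
  rewrite -chrD /z mulrzDr mulr1z; congr chr.
  by rewrite opprB [_ + wt1]addrC !addrA addNr add0r addrC.
have uS n : chr (z (n + 1)) = chr (- wt1) * chr (z n).
  by rewrite -chrD /z mulrzDr mulr1z; congr chr; rewrite opprD addrA addrC.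
have vS n : chr (- z n) = chr (- wt1) * chr (- z (n + 1)).
  by rewrite -vE /z opprB addrC.
elim/int_rect: k => [|k [H hH sH]|k [H hH sH]].
- exists 0; last exact: has_euler_sign0.
  by rewrite mulr0 !mulr0z addr0 subr0 addrC addrA -chrD; rewrite [- wt1 + w]addrC; ring.
- exists (H + (chr (z (k%:Z + 1)) - chr (- z (k%:Z + 1)))); last first.
    by rewrite intS addrC intrD; apply: has_euler_signD => //; apply: has_euler_sign_pair.
  have -> : k.+1%:Z = k%:Z + 1 by rewrite intS addrC.
  rewrite mulrDr hH !uE !vE (uS (k%:Z + 1)) (vS (k%:Z + 1)); ring.
- exists (H - (chr (z (- k%:Z)) - chr (- z (- k%:Z)))); last first.
    have -> : - k.+1%:Z = - k%:Z + -1 by rewrite intS opprD addrC.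
    rewrite intrD; apply: has_euler_signD => //.
    have -> : (-1)%:~R = 1 :> 'F_2 by apply: val_inj.
    by apply/has_euler_signN/has_euler_sign_pair.
  rewrite mulrBr hH !uE !vE.
  have -> : - k.+1%:Z + 1 = - k%:Z by rewrite intS; ring.
  rewrite (uS (- k%:Z)) (vS (- k%:Z)); ring.
Qed.

Lemma mdeg_charMz m u r : mdeg_char m (u *~ r) = mdeg_char m u * r.
Proof.
rewrite mulr_suml; apply: eq_bigr => j _.
by rewrite -scaler_int mxE intz mulrCA mulrC.
Qed.

(** When w = r c, both s V and tilde V consist of the two characters (r - 1) c
    and - r c, so the edge term is 0.  As n(w) = 2 r, the exponent is then
    2 r - 1 + 1, which is even as it should be. *)
Lemma edge_pair m w : \sum_(j < 3) m j = - 2%:Z ->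
  exists2 H : K0T, is_edge m (chr w + chr (wt1 - w)) H
    & has_euler_sign H ((mdeg_char m w - 1)%:~R + (on_diagonal w)%:R).
Proof.
move=> hm.
have tildeV : tilde m (chr w + chr (wt1 - w))
    = chr (w - wt1 *~ mdeg_char m w) + chr (- w + wt1 *~ (mdeg_char m w - 1)).
  rewrite {1}/tilde mapcharD -!/(tilde m _) !tilde_chr mdeg_charB mdeg_wt1 //.
  congr (_ + chr _); rewrite addrAC addrC; congr (- w + _).
  rewrite -{1}[wt1]mulr1z -mulrzBr; congr (_ *~ _); ring.
have dualV : dual (t ord0) * chr (wt1 - w) = chr (- w).
  by rewrite dual_chr -chrD addKr.
have [/on_diagonalP [r wE]|ndiag] := boolP (on_diagonal w).
  have nE : mdeg_char m w = r + r.
    by rewrite wE mdeg_charMz mdeg_wt1 //; ring.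
  exists 0; last first.
    by rewrite nE rmorphB rmorphD /= F2_addrr sub0r addNr; apply: has_euler_sign0.
  rewrite /is_edge mulr0 mulrDr dualV tildeV dual_chr -chrD -/wt1 nE wE.
  have -> : wt1 *~ r - wt1 *~ (r + r) = - (wt1 *~ r).
    by rewrite mulrzDr opprD addrA subrr sub0r.
  have -> : - (wt1 *~ r) + wt1 *~ (r + r - 1) = - wt1 + wt1 *~ r.
    by rewrite mulrzBr mulrzDr mulr1z !addrA addNr add0r addrC.
  ring.
have [H hH sH] := edge_pair_telescope (mdeg_char m w - 1) ndiag.
exists H; last by rewrite addr0.
rewrite /is_edge hH mulrDr dualV tildeV mulrzBr mulr1z.
have -> : w - wt1 - (wt1 *~ mdeg_char m w - wt1) = w - wt1 *~ mdeg_char m w.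
  by rewrite opprB addrA subrK.
ring.
Qed.

(** * The part of the edge term that depends on i *)

Definition box_char (a : box) : character := \row_j (a j)%:Z.

Definition wtl (i : 'I_3) : character := chi (delta_mx 0 (lift ord0 i)).

Lemma wtlE i j : (wtl i : 'rV[int]_3) 0 j = (j == i)%:Z.
Proof. by rewrite !mxE /= (inj_eq lift_inj) subr0 natz. Qed.

Lemma chrMn w n : chr (w *+ n) = chr w ^+ n.
Proof. by elim: n => [|n IH]; rewrite ?mulr0n ?expr0 // mulrS exprS chrD IH. Qed.

Lemma Zlam_chr lam : Zlam lam = \sum_(a <- lam) chr (box_char a).
Proof.
apply: eq_bigr => a _.
have -> : box_char a = \sum_(j < 3) wtl j *+ a j.
  apply/rowP => k; rewrite summxE (bigD1 k) //= big1 ?addr0 => [|j njk].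
    by rewrite -scaler_nat [LHS]mxE [RHS]mxE wtlE eqxx mulr1 natz.
  by rewrite -scaler_nat [LHS]mxE wtlE eq_sym (negPf njk) mulr0.
rewrite (big_morph chr chrD chr0); apply: eq_bigr => j _; exact/esym/chrMn.
Qed.

Lemma prod_1B_two_of_three (R : comNzRingType) (x : 'I_3 -> R) (i : 'I_3) :
  \prod_(k < 3 | k != i) (1 - x k)
  = 1 - \sum_(k < 3) x k + x i + \prod_(k < 3 | k != i) x k.
Proof.
rewrite big_mkcond [X in _ + X]big_mkcond /= !big_ord_recl !big_ord0.
case: i => [[|[|[|//]]] hi] /=; rewrite ?mulr1 ?mul1r ?addr0.
- by rewrite (_ : Ordinal hi = ord0); [ring | apply: val_inj].
- by rewrite (_ : Ordinal hi = lift ord0 ord0); [ring | apply: val_inj].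
- by rewrite (_ : Ordinal hi = lift ord0 (lift ord0 ord0)); [ring | apply: val_inj].
Qed.

(** The product t_k^-1 t_l^-1 in the dual of P_kl is t_1 t_i. *)
Lemma dual_Pkl i : dual (Pkl i)
  = 1 - \sum_(k < 3) dual (t (lift ord0 k)) + chr (- wtl i) + chr (wt1 + wtl i).
Proof.
have sumE : \sum_(k < 3) wtl k = - wt1.
  apply/rowP => j; rewrite summxE (bigD1 j) //= big1 => [|k njk].
    by rewrite wtlE eqxx mxE wt1E.
  by rewrite wtlE eq_sym (negPf njk).
have prodE : \prod_(k < 3 | k != i) t (lift ord0 k) = chr (- (wt1 + wtl i)).
  rewrite /t -(big_morph chr chrD chr0); congr chr.
  by rewrite opprD -sumE [in RHS](bigD1 i) //= addrAC subrr add0r.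
rewrite /Pkl prod_1B_two_of_three prodE /dual !mapcharD.
rewrite (raddfN (mapchar -%R)) (raddf_sum (mapchar -%R)) /=.
by rewrite -[X in mapchar _ X + _]chr0 !mapchar_chr oppr0 opprK.
Qed.

Definition pair_char (i : 'I_3) (a b : box) : character :=
  box_char a - box_char b - wtl i.

Definition fterm_common (lam : {fset box}) : K0T :=
  - Zlam lam
  + (1 - \sum_(k < 3) dual (t (lift ord0 k))) * Zlam lam * dual (Zlam lam).

(** The class t_1 t_i Z Z^* is t_1 times the dual of t_i^-1 Z Z^*; exchanging
    a and b matches each of its terms with a term of the latter. *)
Lemma fterm_split lam i : fterm lam i
  = fterm_common lam + \sum_(a <- lam) \sum_(b <- lam)
      (chr (pair_char i a b) + chr (wt1 - pair_char i a b)).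
Proof.
rewrite /fterm /fterm_common dual_Pkl -[RHS]addrA; congr (_ + _).
set S := 1 - _; rewrite -[S + _ + _]addrA !mulrDl; congr (_ + _).
under [RHS]eq_bigr do rewrite big_split; rewrite big_split /=.
have dZ : dual (Zlam lam) = \sum_(b <- lam) chr (- box_char b).
  rewrite Zlam_chr /dual (raddf_sum (mapchar -%R)) /=.
  by apply: eq_bigr => b _; apply: mapchar_chr.
rewrite dZ Zlam_chr; congr (_ + _); rewrite -mulrA big_distrlr mulr_sumr /=.
  apply: eq_bigr => a _; rewrite mulr_sumr; apply: eq_bigr => b _.
  by rewrite -!chrD addrC.
rewrite [RHS]exchange_big; apply: eq_bigr => a _.
rewrite mulr_sumr; apply: eq_bigr => b _.
by rewrite -!chrD /pair_char !opprB -addrA.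
Qed.

Definition diagonal_pairs (i : 'I_3) (lam : {fset box}) : nat :=
  \sum_(a <- lam) \sum_(b <- lam) on_diagonal (pair_char i a b).

Lemma sum_const_fset (V : nmodType) (lam : {fset box}) (x : V) :
  \sum_(a <- lam) x = x *+ #|` lam|.
Proof. by rewrite big_const_seq count_predT iter_addr addr0. Qed.

(** In the sum of n(a - b - e_i) - 1 over all pairs (a, b), the contributions
    of a and b cancel, which leaves |lambda|^2 (m_i + 1) up to sign; modulo 2,
    the square has the parity of |lambda|. *)
Lemma euler_edge m lam : \sum_(j < 3) m j = - 2%:Z ->
  exists K : K0T, forall i, euler (- edge m lam i)
    = psign (#|` lam|%:R * (m i + 1)%:~R + (diagonal_pairs i lam)%:R) * euler K.
Proof.
move=> hm; have [K /eqP hK] := divides_t1 m (fterm_common lam).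
exists (- K) => i.
have [H hH sH] : exists2 H : K0T,
    is_edge m (\sum_(a <- lam) \sum_(b <- lam)
      (chr (pair_char i a b) + chr (wt1 - pair_char i a b))) H
    & has_euler_sign H (\sum_(a <- lam) \sum_(b <- lam)
       ((mdeg_char m (pair_char i a b) - 1)%:~R + (on_diagonal (pair_char i a b))%:R)).
  pose Q V s := exists2 H : K0T, is_edge m V H & has_euler_sign H s.
  have Q0 : Q 0 0.
    exists 0; last exact: has_euler_sign0.
    by rewrite /is_edge !mulr0 /tilde (raddf0 (mapchar _)) subr0.
  have QD V s W u : Q V s -> Q W u -> Q (V + W) (s + u).
    move=> [E hE sE] [F hF sF]; exists (E + F); first exact: is_edgeD.
    exact: has_euler_signD.
  apply: (big_ind2 Q) => // a _; apply: (big_ind2 Q) => // b _.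
  exact: edge_pair.
have -> : edge m lam i = K + H.
  by apply: (is_edge_inj (edgeP m lam i)); rewrite fterm_split; apply: is_edgeD.
have [N0 eN] := has_euler_signN sH.
rewrite opprD eulerD // eN mulrC; congr (psign _ * _).
under eq_bigr do rewrite big_split; rewrite big_split /=; congr (_ + _); last first.
  by rewrite natr_sum; apply: eq_bigr => a _; rewrite natr_sum.
pose d a : 'F_2 := (mdeg_char m (box_char a))%:~R.
have wE a b : (mdeg_char m (pair_char i a b) - 1)%:~R = d a - d b + (m i + 1)%:~R.
  rewrite !mdeg_charB; have -> : mdeg_char m (wtl i) = m i.
    rewrite /mdeg_char (bigD1 i) //= big1 ?addr0 => [|k nki].
      by rewrite wtlE eqxx mulr1.
    by rewrite wtlE (negPf nki) mulr0.
  by rewrite !rmorphB rmorphD /= -!/(d _) -addrA -opprD [- (_ + 1)]F2_oppr.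
under eq_bigr => a _ do (under eq_bigr => b _ do rewrite wE; rewrite big_split).
rewrite big_split /= !sum_const_fset.
have -> : \sum_(a <- lam) \sum_(b <- lam) (d a - d b) = 0.
  by under eq_bigr do rewrite sumrB; rewrite sumrB exchange_big subrr.
by rewrite add0r -mulrnA -[LHS]mulr_natl natrM F2_mulrr.
Qed.

(** * Parity of the number of diagonal pairs *)

Definition same_diagonal (p q : box) : bool :=
  [forall j, p j + q ord0 == p ord0 + q j]%N.

(** For {i, k, l} = {2, 3, 4}, [incr_at i a] is a + e_i and [incr_off i a] is
    a + e_k + e_l, which lies on the same diagonal as a - e_i while staying in
    the positive octant. *)
Definition incr_at (i : 'I_3) (a : box) : box := [ffun j => a j + (j == i)]%N.
Definition incr_off (i : 'I_3) (a : box) : box := [ffun j => a j + (j != i)]%N.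

Definition min_coord (a : box) : nat :=
  minn (a ord0) (minn (a (lift ord0 ord0)) (a (lift ord0 (lift ord0 ord0)))).

Lemma forall_I3 (P : 'I_3 -> Prop) :
  P ord0 -> P (lift ord0 ord0) -> P (lift ord0 (lift ord0 ord0)) -> forall j, P j.
Proof.
move=> P0 P1 P2 [[|[|[|//]]] hj].
- by rewrite (_ : Ordinal hj = ord0) //; apply: val_inj.
- by rewrite (_ : Ordinal hj = lift ord0 ord0) //; apply: val_inj.
- by rewrite (_ : Ordinal hj = lift ord0 (lift ord0 ord0)) //; apply: val_inj.
Qed.

Lemma min_coord_le (a : box) j : (min_coord a <= a j)%N.
Proof. by move: j; apply: forall_I3; rewrite /min_coord; lia. Qed.

Lemma min_coord_attained (a : box) : exists j, a j = min_coord a.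
Proof.
rewrite /min_coord; set x := a _; set y := a _; set z := a _.
set n := minn _ _; have [|[|]] : n = x \/ n = y \/ n = z by lia.
- by exists ord0.
- by exists (lift ord0 ord0).
- by exists (lift ord0 (lift ord0 ord0)).
Qed.

Lemma on_diagonal_incr_at i a b :
  on_diagonal (pair_char i a b) = same_diagonal a (incr_at i b).
Proof.
have cE j : (pair_char i a b : 'rV[int]_3) 0 j = (a j)%:Z - (b j)%:Z - (j == i)%:Z.
  by rewrite [LHS]mxE [X in _ + X]mxE wtlE !mxE.
apply: eq_forallb => j; rewrite !cE !ffunE.
by case: (j == i); case: (ord0 == i) => /=; lia.
Qed.

Lemma on_diagonal_incr_off i a b :
  on_diagonal (pair_char i a b) = same_diagonal b (incr_off i a).
Proof.
rewrite on_diagonal_incr_at.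
apply: eq_forallb => j; rewrite !ffunE.
by case: (j == i); case: (ord0 == i) => /=; lia.
Qed.

(** The box q is the first one outside of lam on its diagonal: the boxes of
    lam on this diagonal are q - (1, 1, 1), q - (2, 2, 2), and so on until a
    coordinate vanishes. *)
Lemma card_same_diagonal (lam : {fset box}) (q : box) :
  plane_partition lam -> q \notin lam ->
  ((0 < min_coord q)%N -> [ffun j => (q j).-1] \in lam) ->
  (\sum_(b <- lam) same_diagonal b q)%N = min_coord q.
Proof.
move=> hlam nq q1.
pose down s : box := [ffun j => q j - s.+1]%N.
have -> : (\sum_(b <- lam) same_diagonal b q)%N
        = size (filter (same_diagonal^~ q) lam).
  rewrite size_filter -sum1_count [RHS]big_mkcond.
  by apply: eq_bigr => b _; case: (same_diagonal b q).
rewrite -(size_iota 0 (min_coord q)) -(size_map down); apply: perm_size.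
apply: uniq_perm; first by rewrite filter_uniq // fset_uniq.
  rewrite map_inj_in_uniq ?iota_uniq // => s u.
  rewrite !mem_iota => hs hu /ffunP /(_ ord0); rewrite !ffunE.
  have := min_coord_le q ord0; lia.
suff mem_eq (b : box) : (b \in [seq x <- lam | same_diagonal x q])
    = (b \in [seq down s | s <- iota 0 (min_coord q)]) by move=> b; exact: mem_eq.
rewrite mem_filter; apply/andP/mapP => [[/forallP bq bl]|[s]].
  (* Otherwise q would be below b, hence in lam. *)
  have [j hj] : exists j : 'I_3, (b j < q j)%N.
    apply/existsP; apply: contraNT nq; rewrite negb_exists => /forallP h.
    by apply: (hlam _ _ bl) => j; rewrite leqNgt; apply: h.
  have delta (k : 'I_3) : (q k - b k)%N = (q j - b j)%N /\ (b k < q k)%N.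
    by move: (bq k) (bq j) => /eqP + /eqP; lia.
  exists (q j - b j).-1.
    have [k <-] := min_coord_attained q; rewrite mem_iota.
    have := delta k; lia.
  suff downE (k : 'I_3) : b k = down (q j - b j).-1 k by apply/ffunP.
  by rewrite ffunE; have := delta k; lia.
rewrite mem_iota => hs ->; split.
  apply/forallP => j; rewrite !ffunE; have := min_coord_le q j.
  have := min_coord_le q ord0; lia.
by apply: (hlam _ _ (q1 _)) => [|j]; rewrite ?ffunE; lia.
Qed.

(** A box with the largest sum of coordinates is a corner. *)
Lemma exists_max_box (lam : {fset box}) : lam != fset0 ->
  exists2 c : box, c \in lam
    & forall a : box, a \in lam -> (forall j, c j <= a j)%N -> a = c.
Proof.
move=> /fset0Pn [c0 c0l].
pose P n := has (fun a : box => n == \sum_(j < 3) a j)%N lam.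
have exP : exists n, P n.
  by exists (\sum_(j < 3) c0 j)%N; apply/hasP; exists c0.
have boundP n : P n -> (n <= \sum_(a <- lam) \sum_(j < 3) a j)%N.
  by move=> /hasP [a al /eqP ->]; rewrite (big_fsetD1 a) //= leq_addr.
case: (ex_maxnP exP boundP) => n /hasP [c cl /eqP nE] maxn.
exists (c : box) => // a al le.
have hle : (\sum_(j < 3) a j <= \sum_(j < 3) (c : box) j)%N.
  by rewrite -nE; apply: maxn; apply/hasP; exists a.
suff eqj (j : 'I_3) : a j = (c : box) j by apply/ffunP.
move: hle (le ord0) (le (lift ord0 ord0)) (le (lift ord0 (lift ord0 ord0))).
by rewrite !big_ord_recl !big_ord0; move: j; apply: forall_I3; lia.
Qed.

Definition leg_box (i : 'I_3) (a : box) : bool :=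
  [forall k, (k != i) ==> (a k < a i)%N]
  && [forall k, forall l, (k != i) && (l != i) ==> (a k == a l)].

Definition unique_min (a : box) : bool :=
  let x := a ord0 in let y := a (lift ord0 ord0) in
  let z := a (lift ord0 (lift ord0 ord0)) in
  [|| (x < y) && (x < z), (y < x) && (y < z) | (z < x) && (z < y)]%N.

Lemma forall_I3b (P : pred 'I_3) : [forall j, P j]
  = [&& P ord0, P (lift ord0 ord0) & P (lift ord0 (lift ord0 ord0))].
Proof.
apply/forallP/and3P => [h|[P0 P1 P2]]; first by split.
exact: forall_I3.
Qed.

(** Relative to min(a), raising a_i raises the minimum exactly when a_i is the
    only smallest coordinate, and raising the other two raises it exactly when
    a_i is not a smallest coordinate.  The term [leg_box i a] corrects the
    remaining asymmetry, when a_i is the largest of the coordinates and the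
    other two coincide. *)
Lemma corner_parity i a :
  odd (min_coord (incr_at i a) + min_coord (incr_off i a) + leg_box i a)
  = unique_min a.
Proof.
rewrite /min_coord /leg_box /unique_min !forall_I3b !ffunE.
set x := a ord0; set y := a _; set z := a _.
move: i; apply: forall_I3 => /=; rewrite -/x -/y -/z; lia.
Qed.

Lemma plane_partitionD1 (lam : {fset box}) (c : box) :
  plane_partition lam ->
  (forall a : box, a \in lam -> (forall j, c j <= a j)%N -> a = c) ->
  plane_partition (lam `\ c)%fset.
Proof.
move=> hlam maxc a b; rewrite !in_fsetD1 => /andP [nbc bl] ab.
rewrite (hlam _ _ bl ab) andbT; apply: contraNneq nbc => ac.
by apply/eqP/maxc => // j; rewrite -ac.
Qed.

Lemma diagonal_pairsD1 i (lam : {fset box}) (c : box) :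
  plane_partition lam -> c \in lam ->
  (forall a : box, a \in lam -> (forall j, c j <= a j)%N -> a = c) ->
  diagonal_pairs i lam = (diagonal_pairs i (lam `\ c)%fset
    + (min_coord (incr_at i c) + min_coord (incr_off i c)))%N.
Proof.
move=> hlam cl maxc; have hmu := plane_partitionD1 hlam maxc.
(* The boxes c + e_i and c + e_k + e_l satisfy the hypotheses of
   card_same_diagonal since c is a corner. *)
have corner (q : box) (k l : 'I_3) : (forall j, c j <= q j <= (c j).+1)%N ->
    q k = (c k).+1 -> q l = c l ->
    (\sum_(b <- lam `\ c) same_diagonal b q)%N = min_coord q.
  move=> cq qk ql; apply: card_same_diagonal => //.
    rewrite in_fsetD1; apply/andP => -[/eqP nqc ql']; apply: nqc.
    by apply: maxc => // j; have /andP[] := cq j.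
  move=> q0; rewrite in_fsetD1; apply/andP; split.
    apply/eqP => qc; have : (q l).-1 = c l by rewrite -qc ffunE.
    by have := min_coord_le q l; lia.
  by apply: (hlam _ _ cl) => j; rewrite ffunE; have := cq j; lia.
have [k nki] : exists k, k != i.
  by move: i; apply: forall_I3; [exists (lift ord0 ord0) | exists ord0 | exists ord0].
have cc : on_diagonal (pair_char i c c) = false.
  rewrite on_diagonal_incr_at; apply/negP => /forallP h.
  move: (h i) (h k); rewrite !ffunE eqxx (negPf nki); case: (ord0 == i); lia.
rewrite /diagonal_pairs (big_fsetD1 c) //= (big_fsetD1 c) //= cc add0n.
under [X in (_ + X)%N]eq_bigr do rewrite (big_fsetD1 c) //=.
rewrite big_split /= [RHS]addnC addnA; congr (_ + _)%N.
rewrite addnC; congr (_ + _)%N.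
  under eq_bigr do rewrite on_diagonal_incr_at.
  apply: (corner _ i k) => [j||]; rewrite ffunE ?eqxx ?(negPf nki);
    first case: (j == i); lia.
under eq_bigr do rewrite on_diagonal_incr_off.
apply: (corner _ k i) => [j||]; rewrite ffunE ?eqxx ?nki;
  first case: (j != i); lia.
Qed.

(** Removing corners one by one, [diagonal_pairsD1] and [corner_parity]
    compute the parity box by box. *)
Lemma diagonal_pairs_parity i (lam : {fset box}) : plane_partition lam ->
  odd (diagonal_pairs i lam + \sum_(a <- lam) leg_box i a)
  = odd (\sum_(a <- lam) unique_min a).
Proof.
move: {2}#|` lam| (leqnn #|` lam|) => n.
elim: n lam => [|n IH] lam.
  rewrite leqn0 cardfs_eq0 => /eqP -> _.
  by rewrite /diagonal_pairs !big_seq_fset0.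
move=> hn hlam; have [->|/exists_max_box [c cl maxc]] := eqVneq lam fset0.
  by rewrite /diagonal_pairs !big_seq_fset0.
rewrite (diagonal_pairsD1 i hlam cl maxc) !(big_fsetD1 c cl) /=.
rewrite [(diagonal_pairs _ _ + _)%N]addnC addnACA oddD corner_parity IH.
- by rewrite [RHS]oddD oddb.
- by move: hn; rewrite (cardfsD1 c) cl.
- exact: plane_partitionD1.
Qed.

(** * Comparison of the signs *)

Lemma F2_natr n : n%:R = (odd n)%:R :> 'F_2.
Proof. by rewrite -{1}(odd_double_half n) natrD -addnn natrD F2_addrr addr0. Qed.

Lemma sigma_F2 m lam i : (sigma m lam i)%:~R
  = (f_m m lam)%:~R + #|` lam|%:R * (m i)%:~R + (\sum_(a <- lam) leg_box i a)%:R :> 'F_2.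
Proof.
rewrite /sigma !rmorphD rmorphM /= -!pmulrn; congr (_ + _%:R).
rewrite card_fset_sum1 big_fset /= big_mkcond.
by apply: eq_bigr => a _; rewrite /leg_box; case: (_ && _).
Qed.

Theorem theorem2p17 (lam : {fset box}) (m : 'I_3 -> int) (i j : 'I_3)
  (hlam : plane_partition lam) (hm : \sum_(k < 3) m k = - 2%:Z) :
  (-1) ^ sigma m lam i * euler (- edge m lam i)
  = (-1) ^ sigma m lam j * euler (- edge m lam j).
Proof.
have [K hK] := euler_edge lam hm.
suff common k : (-1) ^ sigma m lam k * euler (- edge m lam k)
    = psign ((f_m m lam)%:~R + #|` lam|%:R + (\sum_(a <- lam) unique_min a)%:R)
      * euler K by rewrite !common.
rewrite hK psign_int mulrA -psignD; congr (psign _ * _).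
rewrite sigma_F2 [X in _ = _ + X]F2_natr -(diagonal_pairs_parity k hlam).
rewrite -F2_natr natrD intrD mulrDr mulr1.
set x := _%:~R; set y := _ * _; set z := _%:R; set u := _%:R; set v := _%:R.
(* The number y = |lam| m_k, which occurs both in sigma and in euler_edge,
   cancels modulo 2. *)
rewrite -[RHS]addr0 -(F2_addrr y); ring.
Qed.
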